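(* Let $\nu$ be a multiplicative valuation on $K(\chi)$. If the rational rank of $\nu K(\chi)$ over $\nu K$ is $1$, or the transcendence degree of $K(\chi)_\nu$ over $K_\nu$ is $1$ (in other words, if $\chi$ is transcendental and Abhyankar's inequality is an equality), then there is a finite number of key degrees, and $\nu=\nu_\Phi$ (on $K[\chi]$) for some w key polynomial $\Phi$.
   Context: $K$ is a field and $\chi$ generates the simple extension $K(\chi)|K$. A multiplicative valuation is a field valuation in the usual sense; $\nu K$, $\nu K(\chi)$ denote value groups and $K_\nu$, $K(\chi)_\nu$ residue fields. It is assumed that $\nu K$ has finite rank. The rational rank of $\nu K(\chi)$ over $\nu K$ is $\dim_{\mathbb{Q}}(\nu K(\chi)/\nu K)\otimes\mathbb{Q}$. Abhyankar's inequality: the transcendence degree of $K(\chi)|K$ is at least the sum of the transcendence degree of $K(\chi)_\nu|K_\nu$ and the rational rank of $\nu K(\chi)$ over $\nu K$. $K_m[\chi]$ is the $K$-module of polynomials of degree at most $m$. For $\Phi$ monic of degree $d$, $1\le d<[K[\chi]:K]$, and $f,g\in K_{d-1}[\chi]$, $q_\Phi(f,g)$ and $r_\Phi(f,g)$ are the quotient and remainder of the euclidean division of $fg$ by $\Phi$. $\Phi$ is a w key polynomial (resp. a key polynomial) for $\nu$ if $\nu(fg)=\nu(r_\Phi(f,g))$ (resp. $\nu(fg)=\nu(r_\Phi(f,g))<\nu(q_\Phi(f,g)\Phi)$) for all nonzero $f,g\in K_{d-1}[\chi]$ with $\deg(f)+\deg(g)<[K[\chi]:K]$ (a vacuous restriction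 when $\chi$ is transcendental). $d$ is a key degree if there is a key polynomial of degree $d$. For $f=f_0+f_1\Phi+\cdots+f_m\Phi^m$ with $f_i\in K_{d-1}[\chi]$, $\nu_\Phi(f):=\min_{0\le i\le m}(\nu(f_i)+i\nu(\Phi))$. *)

(* Defs.v *)
From HB Require Import structures.
From mathcomp Require Import all_boot all_order all_algebra.
From mathcomp Require Import boolp classical_sets cardinality.
From mathcomp Require Import mpoly.

Set Implicit Arguments.
Unset Strict Implicit.
Unset Printing Implicit Defensive.

Import Order.TTheory GRing.Theory Num.Theory.
Local Open Scope ring_scope.
Local Open Scope quotient_scope.

HB.mixin Record hasTranslationInvariantOrder G of Num.POrderedZmodule G := {
  oag_total : total (<=%R : rel G);
  oag_leD : forall z x y : G, x <= y -> x + z <= y + z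
}.

#[short(type="oagType")]
HB.structure Definition OrderedAbelianGroup :=
  {G of Num.POrderedZmodule G & hasTranslationInvariantOrder G}.

(* [None] stands for the element infinity added on top of [G]. *)
Section Extended.
Variable G : oagType.
Implicit Types a b : option G.

Definition xle a b : bool :=
  match a, b with
  | _, None => true
  | None, Some _ => false
  | Some x, Some y => x <= y
  end.

Definition xlt a b : bool := ~~ xle b a.

Definition xadd a b : option G :=
  match a, b with
  | Some x, Some y => Some (x + y)
  | _, _ => None
  end.

Definition xmuln a (n : nat) : option G := iter n (xadd a) (Some 0).

Definition xmin a b : option G := if xle a b then a else b.

End Extended.

Record valuation (F : fieldType) (G : oagType) := Valuation {
  val_fun :> F -> option G;
  val_eq0 : forall x, val_fun x = None <-> x = 0;
  valM : forall x y, val_fun (x * y) = xadd (val_fun x) (val_fun y);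
  valD : forall x y, xle (xmin (val_fun x) (val_fun y)) (val_fun (x + y))
}.

Section OagTheory.
Variable G : oagType.

Lemma oag_leD2 (x y z t : G) : x <= y -> z <= t -> x + z <= y + t.
Proof.
move=> xy zt; apply: le_trans (oag_leD z _ _ xy) _.
by rewrite ![y + _]addrC; apply: oag_leD.
Qed.

Lemma oag_dbl0 (x : G) : x + x = 0 -> x = 0.
Proof.
move=> xx0; have /orP[x0|x0] := oag_total x 0;
  have := oag_leD x _ _ x0; rewrite xx0 add0r => x0';
  by apply/eqP; rewrite eq_le x0 x0'.
Qed.

Implicit Types a b c d : option G.

Lemma xlexx a : xle a a.
Proof. by case: a => /=. Qed.

Lemma xle_trans b a c : xle a b -> xle b c -> xle a c.
Proof. by case: a b c => [x|] [y|] [z|] //=; apply: le_trans. Qed.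

Lemma xle_total a b : xle a b || xle b a.
Proof. by case: a b => [x|] [y|] //=; apply: oag_total. Qed.

Lemma xltW a b : xlt a b -> xle a b.
Proof. by move=> /negPf ba; have := xle_total a b; rewrite ba orbF. Qed.

Lemma xlt_le_trans b a c : xlt a b -> xle b c -> xlt a c.
Proof. by move=> ab bc; apply: contra ab; apply: xle_trans. Qed.

Lemma xle_min a b c : xle a b -> xle a c -> xle a (xmin b c).
Proof. by rewrite /xmin; case: ifP. Qed.

Lemma xlt_min a b c : xlt a b -> xlt a c -> xlt a (xmin b c).
Proof. by rewrite /xmin; case: ifP. Qed.

Lemma xaddA : associative (@xadd G).
Proof. by case=> [x|] [y|] [z|] //=; rewrite addrA. Qed.

Lemma xaddC : commutative (@xadd G).
Proof. by case=> [x|] [y|] //=; rewrite addrC. Qed.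

Lemma xadd0a a : xadd (Some 0) a = a.
Proof. by case: a => //= x; rewrite add0r. Qed.

Lemma xle_add a b c d : xle a b -> xle c d -> xle (xadd a c) (xadd b d).
Proof. by case: a b c d => [x|] [y|] [z|] [t|] //=; apply: oag_leD2. Qed.

End OagTheory.

Section ValuationTheory.
Variables (F : fieldType) (G : oagType) (nu : valuation F G).

Lemma val0 : nu 0 = None.
Proof. exact/val_eq0. Qed.

Lemma val_neq0 x : x != 0 -> exists g, nu x = Some g.
Proof.
move=> /eqP x0; case E: (nu x) => [g|]; first by exists g.
by case: x0; apply/(val_eq0 nu).
Qed.

Lemma val1 : nu 1 = Some 0.
Proof.
have [g Eg] := val_neq0 (oner_neq0 F).
have := valM nu 1 1; rewrite mulr1 Eg /= => -[] E.
by congr Some; apply: (addrI g); rewrite -E addr0.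
Qed.

Lemma valN1 : nu (-1) = Some 0.
Proof.
have [g Eg] : exists g, nu (-1) = Some g.
  by apply: val_neq0; rewrite oppr_eq0 oner_neq0.
have := valM nu (-1) (-1); rewrite mulrNN mulr1 val1 Eg /= => -[] /esym E.
by rewrite (oag_dbl0 E).
Qed.

Lemma valN x : nu (- x) = nu x.
Proof. by rewrite -mulN1r valM valN1; case: (nu x) => //= g; rewrite add0r. Qed.

Lemma valV x g : nu x = Some g -> nu x^-1 = Some (- g).
Proof.
move=> Eg; have x0 : x != 0 by apply/eqP => x0; rewrite x0 val0 in Eg.
have [h Eh] : exists h, nu x^-1 = Some h by apply: val_neq0; rewrite invr_eq0.
have := valM nu x x^-1; rewrite divff // val1 Eg Eh /= => -[] E.
by congr Some; apply: (addrI g); rewrite -E subrr.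
Qed.

End ValuationTheory.

Section ValueGroup.
Variables (F : fieldType) (G : oagType) (nu : valuation F G).

Definition in_value_group : {pred G} :=
  fun g => `[< exists x : F, nu x = Some g >].

Lemma value_group_closed : zmod_closed in_value_group.
Proof.
split=> [|g h]; first by apply/asboolP; exists 1; apply: val1.
move=> /asboolP[x Ex] /asboolP[y Ey]; apply/asboolP; exists (x / y).
by rewrite valM Ex (valV Ey).
Qed.

HB.instance Definition _ :=
  GRing.isZmodClosed.Build G in_value_group value_group_closed.

Record value_group := ValueGroup {
  vg_val : G;
  vg_valP : vg_val \in in_value_group
}.

HB.instance Definition _ := [isSub for vg_val].
HB.instance Definition _ := [Choice of value_group by <:].
HB.instance Definition _ := [SubChoice_isSubZmodule of value_group by <:].
HB.instance Definition _ :=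
  [SubChoice_isSubPOrder of value_group by <: with ring_display].

Lemma value_group_total : total (<=%R : rel value_group).
Proof. by move=> x y; rewrite !leEsub; apply: oag_total. Qed.

Lemma value_group_leD (z x y : value_group) : x <= y -> x + z <= y + z.
Proof. by rewrite !leEsub !raddfD; apply: oag_leD. Qed.

HB.instance Definition _ := hasTranslationInvariantOrder.Build value_group
  value_group_total value_group_leD.

End ValueGroup.

Section Rank.
Variable G : oagType.

Definition convex_subgroup (H : set G) : Prop :=
  [/\ H 0,
      forall x y, H x -> H y -> H (x - y) &
      forall x y, 0 <= x -> x <= y -> H y -> H x].

Definition finite_rank : Prop := finite_set [set H | convex_subgroup H].

End Rank.

Section ResidueField.
Variables (F : fieldType) (G : oagType) (nu : valuation F G).

Definition in_val_ring : {pred F} := fun x => xle (Some 0) (nu x).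

Lemma val_ring_closed : subring_closed in_val_ring.
Proof.
split=> [|x y x0 y0|x y x0 y0]; rewrite unfold_in /in_val_ring.
- by rewrite val1 xlexx.
- by apply: xle_trans (valD nu x (- y)); rewrite valN; apply: xle_min.
- by rewrite valM -[Some 0]xadd0a; apply: xle_add.
Qed.

HB.instance Definition _ :=
  GRing.isSubringClosed.Build F in_val_ring val_ring_closed.

Record val_ring := ValRing {
  vr_val : F;
  vr_valP : vr_val \in in_val_ring
}.

HB.instance Definition _ := [isSub for vr_val].
HB.instance Definition _ := [Choice of val_ring by <:].
HB.instance Definition _ := [SubChoice_isSubComNzRing of val_ring by <:].

Definition in_max_ideal : {pred val_ring} := fun x => xlt (Some 0) (nu (val x)).

Lemma max_ideal_closed : idealr_closed in_max_ideal.
Proof.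
split=> [||a x y x0 y0]; rewrite unfold_in /in_max_ideal.
- by rewrite raddf0 val0.
- by rewrite rmorph1 val1 /xlt xlexx.
apply: xlt_le_trans (_ : xle (xmin (nu (val (a * x))) (nu (val y))) _);
  last by rewrite rmorphD; apply: valD.
apply: xlt_min => //; rewrite rmorphM valM.
apply: xlt_le_trans x0 _; rewrite -[X in xle X _]xadd0a.
by apply: xle_add; rewrite ?xlexx //; apply: (vr_valP a).
Qed.

HB.instance Definition _ := isIdealr.Build val_ring in_max_ideal
  max_ideal_closed.

Definition residue_field : Type := {ideal_quot in_max_ideal}.
HB.instance Definition _ := GRing.ComNzRing.on residue_field.

Definition residue (x : val_ring) : residue_field := \pi x.
Lemma residue_additive : zmod_morphism residue.
Proof. exact: (rmorphB (\pi_{ideal_quot in_max_ideal})). Qed.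

Lemma residue_multiplicative : monoid_morphism residue.
Proof.
by split=> [|x y];
  [exact: (rmorph1 (\pi_{ideal_quot in_max_ideal}))
  |exact: (rmorphM (\pi_{ideal_quot in_max_ideal}))].
Qed.

HB.instance Definition _ := GRing.isZmodMorphism.Build val_ring residue_field
  residue residue_additive.
HB.instance Definition _ := GRing.isMonoidMorphism.Build val_ring residue_field
  residue residue_multiplicative.

Definition residue_inv (x : residue_field) : residue_field :=
  if x == 0 then 0 else residue (insubd 0 (val (repr x))^-1).

Lemma residue_eq0 x : (residue x == 0) = (x \in in_max_ideal).
Proof. by rewrite -[x in RHS]subr0 Quotient.idealrBE -(rmorph0 residue). Qed.

Lemma residue_mulV x : x != 0 -> residue_inv x * x = 1.
Proof.
rewrite /residue_inv => x0; rewrite (negPf x0).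
have Ex : x = residue (repr x) by rewrite /residue reprK.
rewrite [in X in _ * X]Ex; move: x0; rewrite Ex residue_eq0 -Ex.
rewrite unfold_in /in_max_ideal /xlt negbK => y0.
have y1 : xle (Some 0) (nu (val (repr x))) := vr_valP (repr x).
case E : (nu (val (repr x))) y0 y1 => [g|] //= g0 g1.
have {g0 g1}Eg : g = 0 by apply/eqP; rewrite eq_le g0.
have yV : (val (repr x))^-1 \in in_val_ring.
  by rewrite unfold_in /in_val_ring (valV E) Eg oppr0 xlexx.
rewrite -rmorphM -(rmorph1 residue); congr residue; apply: val_inj.
rewrite rmorphM rmorph1 /= insubdK // mulVf //.
by apply/eqP => y0; have := val0 nu; rewrite -y0 E.
Qed.

Lemma residue_inv0 : residue_inv 0 = 0.
Proof. by rewrite /residue_inv eqxx. Qed.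

HB.instance Definition _ := GRing.ComNzRing_isField.Build residue_field
  residue_mulV residue_inv0.

End ResidueField.

Section Restriction.
Variables (K L : fieldType) (iota : {rmorphism K -> L}) (G : oagType).
Variable nu : valuation L G.

Lemma restriction_eq0 x : nu (iota x) = None <-> x = 0.
Proof.
rewrite val_eq0; split=> [/eqP|->]; last exact: rmorph0.
by rewrite fmorph_eq0 => /eqP.
Qed.

Lemma restrictionM x y :
  nu (iota (x * y)) = xadd (nu (iota x)) (nu (iota y)).
Proof. by rewrite rmorphM valM. Qed.

Lemma restrictionD x y :
  xle (xmin (nu (iota x)) (nu (iota y))) (nu (iota (x + y))).
Proof. by rewrite rmorphD valD. Qed.

Definition restriction : valuation K G :=
  Valuation restriction_eq0 restrictionM restrictionD.

Definition in_base_value_group : {pred value_group nu} :=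
  fun g => val g \in in_value_group restriction.

Lemma base_value_group_closed : zmod_closed in_base_value_group.
Proof.
have [G0 GB] := value_group_closed restriction.
by split=> [|g h gG hG]; [exact: G0 | exact: GB gG hG].
Qed.

HB.instance Definition _ := GRing.isZmodClosed.Build (value_group nu)
  in_base_value_group base_value_group_closed.

(* nu L / nu K; [{ideal_quot _}] is also the quotient of an abelian group by a
   subgroup. *)
Definition value_group_quotient : zmodType := {ideal_quot in_base_value_group}.

Definition val_ring_map (x : val_ring restriction) : val_ring nu :=
  ValRing (vr_valP x : iota (val x) \in in_val_ring nu).

Lemma val_ring_map_additive : zmod_morphism val_ring_map.
Proof. by move=> x y; apply: val_inj; rewrite /= !rmorphB. Qed.

Lemma val_ring_map_multiplicative : monoid_morphism val_ring_map.
Proof.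
by split=> [|x y]; apply: val_inj; rewrite /= ?rmorph1 // !rmorphM.
Qed.

HB.instance Definition _ := GRing.isZmodMorphism.Build
  (val_ring restriction) (val_ring nu) val_ring_map val_ring_map_additive.
HB.instance Definition _ := GRing.isMonoidMorphism.Build
  (val_ring restriction) (val_ring nu) val_ring_map
  val_ring_map_multiplicative.

Definition residue_field_map (x : residue_field restriction) :
  residue_field nu := residue (val_ring_map (repr x)).

Lemma residue_field_mapE x :
  residue_field_map (residue x) = residue (val_ring_map x).
Proof.
apply/eqP; rewrite -subr_eq0 -rmorphB -rmorphB residue_eq0.
suff: repr (residue x) - x \in @in_max_ideal _ _ restriction by [].
by rewrite -residue_eq0 rmorphB subr_eq0; apply/eqP; exact: reprK.
Qed.

Lemma residueP x : exists y, x = residue y :> residue_field restriction.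
Proof. by exists (repr x); apply: esym; apply: reprK. Qed.

Lemma residue_field_map_additive : zmod_morphism residue_field_map.
Proof.
move=> x y; have [[{}x ->] [{}y ->]] := (residueP x, residueP y).
by rewrite -rmorphB !residue_field_mapE !rmorphB.
Qed.

Lemma residue_field_map_multiplicative : monoid_morphism residue_field_map.
Proof.
split=> [|x y]; first by rewrite -(rmorph1 (@residue _ _ restriction))
  residue_field_mapE !rmorph1.
have [[{}x ->] [{}y ->]] := (residueP x, residueP y).
by rewrite -rmorphM !residue_field_mapE !rmorphM.
Qed.

HB.instance Definition _ := GRing.isZmodMorphism.Build
  (residue_field restriction) (residue_field nu) residue_field_map
  residue_field_map_additive.
HB.instance Definition _ := GRing.isMonoidMorphism.Build
  (residue_field restriction) (residue_field nu) residue_field_map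
  residue_field_map_multiplicative.

End Restriction.

Arguments residue_field_map {K L} iota {G} nu x.

Section TranscendenceDegree.
Variables (k l : fieldType) (iota : {rmorphism k -> l}).

Definition alg_independent n (h : 'I_n -> l) : Prop :=
  forall p : {mpoly k[n]}, mmap iota h p = 0 -> p = 0.

Definition transcendence_degree_is (n : nat) : Prop :=
  (exists h : 'I_n -> l, alg_independent h) /\
  (forall m (h : 'I_m -> l), alg_independent h -> (m <= n)%N).

End TranscendenceDegree.

(* The universal property of a |-> a \otimes 1 : A -> A \otimes_Z Q among
   additive maps from [A] to rational vector spaces. *)
Definition is_rationalization (A : zmodType) (V : lmodType rat)
    (t : {additive A -> V}) : Prop :=
  forall (W : lmodType rat) (f : {additive A -> W}),
    exists2 g : {linear V -> W}, (forall a, g (t a) = f a) &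
      forall g' : {linear V -> W}, (forall a, g' (t a) = f a) -> g' =1 g.

Definition dimension_is (k : fieldType) (V : lmodType k) (n : nat) : Prop :=
  exists e : 'I_n -> V,
    (forall c : 'I_n -> k, \sum_i c i *: e i = 0 -> forall i, c i = 0) /\
    (forall v, exists c : 'I_n -> k, v = \sum_i c i *: e i).

Definition rational_rank_is (A : zmodType) (n : nat) : Prop :=
  exists (V : lmodType rat) (t : {additive A -> V}),
    is_rationalization t /\ dimension_is V n.

Section KeyPolynomials.
Variables (K L : fieldType) (iota : {rmorphism K -> L}) (chi : L).

Definition eval (p : {poly K}) : L := (map_poly iota p).[chi].

Definition is_generator : Prop :=
  forall x : L, exists p q : {poly K}, eval q != 0 /\ x = eval p / eval q.

(* m < [K[chi] : K], the dimension of K[chi] over K being possibly infinite *)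
Definition lt_degree (m : nat) : Prop :=
  exists p : 'I_m.+1 -> {poly K}, forall c : 'I_m.+1 -> K,
    \sum_i iota (c i) * eval (p i) = 0 -> forall i, c i = 0.

Variables (G : oagType) (nu : valuation L G).

Definition nu_eval (p : {poly K}) : option G := nu (eval p).

(* Elements of K_m[chi] with m < [K[chi] : K] are represented by the polynomials
   of degree at most m; [size p] is the degree of [p] plus one. *)
Definition w_key_polynomial (Phi : {poly K}) : Prop :=
  let d := (size Phi).-1 in
  [/\ Phi \is monic, (1 <= d)%N, lt_degree d &
    forall f g : {poly K}, f != 0 -> g != 0 ->
      (size f <= d)%N -> (size g <= d)%N ->
      lt_degree ((size f).-1 + (size g).-1) ->
      nu_eval (f * g) = nu_eval ((f * g) %% Phi)].

Definition key_polynomial (Phi : {poly K}) : Prop :=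
  let d := (size Phi).-1 in
  [/\ Phi \is monic, (1 <= d)%N, lt_degree d &
    forall f g : {poly K}, f != 0 -> g != 0 ->
      (size f <= d)%N -> (size g <= d)%N ->
      lt_degree ((size f).-1 + (size g).-1) ->
      nu_eval (f * g) = nu_eval ((f * g) %% Phi) /\
      xlt (nu_eval ((f * g) %% Phi)) (nu_eval ((f * g) %/ Phi * Phi))].

Definition key_degree (d : nat) : Prop :=
  exists2 Phi : {poly K}, key_polynomial Phi & size Phi = d.+1.

(* The coefficients of the Phi-adic expansion of f, see [expansionE]. *)
Definition expansion_coef (Phi f : {poly K}) (i : nat) : {poly K} :=
  (f %/ Phi ^+ i) %% Phi.

Lemma size_expansion_coef (Phi f : {poly K}) i :
  Phi != 0 -> (size (expansion_coef Phi f i) < size Phi)%N.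
Proof. by move=> Phi0; rewrite ltn_modp. Qed.

Lemma expansionE (Phi f : {poly K}) : (1 < size Phi)%N ->
  f = \sum_(i < size f) expansion_coef Phi f i * Phi ^+ i.
Proof.
move=> sPhi; have Phi0 : Phi != 0 by rewrite -size_poly_gt0 ltnW.
have E n : f = \sum_(i < n) expansion_coef Phi f i * Phi ^+ i +
               f %/ Phi ^+ n * Phi ^+ n.
  elim: n => [|n IHn]; first by rewrite big_ord0 add0r expr0 divp1 mulr1.
  rewrite big_ord_recr -addrA {1}IHn; congr (_ + _).
  rewrite exprSr -divp_divl mulrA [_ * _ * Phi]mulrAC -mulrDl addrC.
  by rewrite -divp_eq.
rewrite {1}[f](E (size f)) divp_small ?mul0r ?addr0 //.
rewrite (@polySpred _ (Phi ^+ _)) ?expf_neq0 // size_exp ltnS leq_pmull //.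
by case: (size Phi) sPhi => [|[]].
Qed.

(* The coefficients of index at least [size f] vanish, and the terms with zero
   coefficient have value infinity. *)
Definition expansion_val (Phi f : {poly K}) : option G :=
  \big[@xmin G/None]_(i < size f)
    xadd (nu_eval (expansion_coef Phi f i)) (xmuln (nu_eval Phi) i).

End KeyPolynomials.

(* Main.v *)
(* Let A be the set of nonzero x in L with x^n = u a for some n > 0, a in K* and
   some u of value 0 whose residue is algebraic over K_nu.  It is a subgroup of
   L* closed under taking roots, and A = L* would make nu L / nu K torsion and
   the residue extension algebraic; so some polynomial takes a nonzero value
   outside A.  Let Phi be monic of minimal degree d with this property.

   If c_0, ..., c_m lie in A or vanish, and phi is not in A, then the value of
   sum c_i phi^i is the minimum of the values of its terms.  Otherwise the terms
   of least value cancel in the residue field; with e > 0 minimal such that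
   nu(phi^e) = nu(h) for some h in A, the exponents of these terms are congruent
   modulo e, and the cancellation is an algebraic equation for the residue of
   phi^e / h, which would put phi in A.  Applied to phi = Phi(chi) this is
   nu = nu_Phi.

   If nu(f g) < nu(r) with f g = q Phi + r, then q Phi and f g have the same
   leading part, so q Phi and hence Phi would be in A: thus Phi is a w key
   polynomial.  If Psi were a key polynomial of degree greater than d, then, for
   g the quotient of Psi by Phi, the quotient of Phi g by Psi is 1, so that nu(Phi g) < nu(Psi),
   contradicting nu = nu_Phi.  So all key degrees are at most d. *)
From HB Require Import structures.
Require Import Defs.
From mathcomp Require Import all_boot all_order all_algebra.
From mathcomp Require Import boolp classical_sets cardinality.
From mathcomp Require Import mpoly zify.

Set Implicit Arguments.
Unset Strict Implicit.
Unset Printing Implicit Defensive.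
Local Open Scope ring_scope.
Local Open Scope classical_set_scope.
Import Order.TTheory GRing.Theory Num.Theory.
Import Defs.

(** * Algebraic elements, transcendence degree and rational rank *)

Section AlgebraicOver.
Variables (k l : fieldType) (j : {rmorphism k -> l}).

(** Over a field, algebraic and integral elements agree, so this is transitivity of integrality. *)
Lemma algebraic_root (p : {poly l}) x :
  p != 0 -> root p x -> (forall i, algebraicOver j p`_i) -> algebraicOver j x.
Proof.
move=> p0 px palg; apply/integral_algebraic; apply: integral_root p0 px _.
by apply/integral_poly => i; apply/integral_algebraic.
Qed.

Lemma algebraic_exp x n : algebraicOver j x -> algebraicOver j (x ^+ n).
Proof.
move=> xalg; elim: n => [|n IHn]; first by rewrite expr0; apply: algebraic1.
by rewrite exprS; apply: algebraic_mul.
Qed.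

Lemma algebraic_of_exp x n :
  (0 < n)%N -> algebraicOver j (x ^+ n) -> algebraicOver j x.
Proof.
move=> n0 xalg; apply: (@algebraic_root ('X^n - (x ^+ n)%:P)).
- by rewrite -size_poly_gt0 size_XnsubC.
- by rewrite rootE !hornerE subrr.
move=> i; rewrite coefB coefXn coefC; apply: algebraic_sub.
  by case: (i == n); [apply: algebraic1 | apply: algebraic0].
by case: (i == 0%N) => //; apply: algebraic0.
Qed.

(** The member of an algebraically independent family of length one is transcendental. *)
Lemma transcendence_degree1_ex :
  transcendence_degree_is j 1 -> exists x, ~ algebraicOver j x.
Proof.
move=> [[h hind] _]; exists (h ord0) => -[p p0 px].
(* The polynomial [p], read as a multivariate polynomial in one indeterminate. *)
pose q := \sum_(i < size p) p`_i *: 'X_ord0 ^+ i : {mpoly k[1]}.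
suff q0 : q = 0.
  case/eqP: p0; apply/polyP => i; rewrite coef0.
  have [ip|] := ltnP i (size p); last exact: nth_default.
  have := congr1 (mcoeff (U_(ord0) *+ i)%MM) q0.
  rewrite mcoeff0 raddf_sum (bigD1 (Ordinal ip)) //= big1 => [|m mi].
    by rewrite mcoeffZ mcoeffXn eqxx mulr1 addr0.
  rewrite mcoeffZ mcoeffXn; case: eqP => [|_]; last by rewrite mulr0.
  move/mnmP/(_ ord0); rewrite !mulmnE !mnm1E eqxx !mul1n => E.
  by case/eqP: mi; apply: val_inj.
apply: hind; rewrite /q raddf_sum /=.
rewrite -[RHS](eqP px) horner_poly; apply: eq_bigr => i _.
by rewrite mmapZ rmorphXn /= mmapX mmap1U.
Qed.

End AlgebraicOver.

(** If [A] were torsion, [t] would vanish, so the identity and the zero map of [V] would both factor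
    [t] through itself. Uniqueness would make [V] zero, against a basis of positive length. *)
Lemma rational_rank_non_torsion (A : zmodType) n :
  rational_rank_is A n -> (0 < n)%N ->
  exists a : A, forall m, (0 < m)%N -> a *+ m != 0.
Proof.
move=> [V [t [tuniv [e [efree _]]]]] n0; apply/not_existsP => tors.
have t0 a : t a = 0.
  have /existsNP[m /not_implyP[m0 /negP/negbNE/eqP am0]] := tors a.
  have : m%:R *: t a = 0 by rewrite scaler_nat -raddfMn am0 raddf0.
  by move/eqP; rewrite scaler_eq0 pnatr_eq0 -[m == 0%N]negbK -lt0n m0 => /eqP.
have [g gt guniq] := tuniv V t.
have V0 (v : V) : v = 0.
  have := guniq idfun (fun a => erefl) v.
  have := guniq (\0 : {linear V -> V}) (fun a => esym (t0 a)) v.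
  by move=> <- /= ->.
have /eqP := efree (fun=> 1) (V0 _) (Ordinal n0).
by rewrite oner_eq0.
Qed.

(** * The ordered group with infinity *)

Section Order.
Variable G : oagType.
Implicit Types (g : G) (a b : option G).

Lemma xle_anti a b : xle a b -> xle b a -> a = b.
Proof.
by case: a b => [x|] [y|] //= xy yx; congr Some; apply/eqP; rewrite eq_le xy yx.
Qed.

Lemma xlt_irr a : ~~ xlt a a.
Proof. by rewrite negbK xlexx. Qed.

Lemma xle_addr2 g a b : xle (xadd a (Some g)) (xadd b (Some g)) = xle a b.
Proof.
case: a b => [x|] [y|] //=; apply/idP/idP; last exact: oag_leD.
by move/(oag_leD (- g)); rewrite !addrK.
Qed.

Lemma xle_lt_trans b a c : xle a b -> xlt b c -> xlt a c.
Proof. by move=> ab; apply: contra => ca; apply: xle_trans ca ab. Qed.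

Lemma xlt_neq a b : xle a b -> a <> b -> xlt a b.
Proof. by move=> ab neq; apply/negP => /(xle_anti ab). Qed.

Lemma xle_bigmin (I : eqType) (s : seq I) (F : I -> option G) a :
  xle a (\big[@xmin G/None]_(i <- s) F i) <->
  forall i, i \in s -> xle a (F i).
Proof.
elim: s => [|i s IHs]; first by rewrite big_nil; case: a.
have minP b c : xle a (xmin b c) <-> xle a b /\ xle a c.
  split=> [|[]]; last exact: xle_min.
  rewrite /xmin; case: ifP => [bc ab|/negbT/xltW cb ac]; split=> //.
    exact: xle_trans bc.
  exact: xle_trans cb.
rewrite big_cons minP IHs; split=> [[ai as_] m|H].
  by rewrite inE => /predU1P[->|] //; apply: as_.
by split=> [|m ms]; apply: H; rewrite inE ?eqxx ?ms ?orbT.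
Qed.

End Order.

(** * Values and residues of field elements *)

Section Valuation.
Variables (F : fieldType) (G : oagType) (nu : valuation F G).
Implicit Types x y : F.

Lemma valX x n : nu (x ^+ n) = xmuln (nu x) n.
Proof.
elim: n => [|n IHn]; first by rewrite expr0 val1.
by rewrite exprS valM IHn.
Qed.

Lemma val_sum_ge I (r : seq I) (P : pred I) (H : I -> F) a :
  (forall i, P i -> xle a (nu (H i))) -> xle a (nu (\sum_(i <- r | P i) H i)).
Proof.
move=> aH; apply: (big_ind (fun x => xle a (nu x))) => //.
  by rewrite val0; case: a {aH}.
by move=> x y ax ay; apply: xle_trans (valD nu x y); apply: xle_min.
Qed.

Lemma valB_ge x y a : xle a (nu x) -> xle a (nu y) -> xle a (nu (x - y)).
Proof.
by move=> ax ay; apply: xle_trans (valD _ _ _); apply: xle_min; rewrite ?valN.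
Qed.

Lemma xle_val_div x y z : z != 0 ->
  xle (nu (x / z)) (nu (y / z)) = xle (nu x) (nu y).
Proof.
move=> z0; have /(val_neq0 nu)[g zg] := z0.
by rewrite -(xle_addr2 g) -zg -!valM !divfK.
Qed.

Lemma xlt_val_div x y : y != 0 ->
  xlt (Some 0) (nu (x / y)) = xlt (nu y) (nu x).
Proof. by move=> y0; rewrite /xlt -(val1 nu) -(divff y0) xle_val_div. Qed.

Lemma val_div_eq0 x y : y != 0 -> nu (x / y) = Some 0 <-> nu x = nu y.
Proof.
move=> y0; split=> [xy|xy]; first by rewrite -[x](divfK y0) valM xy xadd0a.
by have /(val_neq0 nu)[g yg] := y0; rewrite valM xy yg (valV yg) /= subrr.
Qed.

Lemma val_neq0_unit x : nu x = Some 0 -> x != 0.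
Proof. by move=> x0; apply/eqP => E; rewrite E val0 in x0. Qed.

Lemma val_unitX x n : nu x = Some 0 -> nu (x ^+ n) = Some 0.
Proof.
by move=> x0; rewrite valX x0; elim: n => //= n ->; rewrite /= addr0.
Qed.

Lemma val_unitV x : nu x = Some 0 -> nu x^-1 = Some 0.
Proof. by move/valV ->; rewrite oppr0. Qed.

(* Junk value: [res x = 0] when [x] is outside the valuation ring. *)
Definition res x : residue_field nu := residue (insubd (0 : val_ring nu) x).

Lemma insubd_ring x :
  xle (Some 0) (nu x) -> val (insubd (0 : val_ring nu) x) = x.
Proof. by move=> x0; rewrite insubdK. Qed.

Lemma resE (y : val_ring nu) : residue y = res (val y).
Proof. by rewrite /res valKd. Qed.

Lemma res_eq0 x : xle (Some 0) (nu x) -> (res x == 0) = xlt (Some 0) (nu x).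
Proof. by move=> x0; rewrite residue_eq0 unfold_in insubd_ring. Qed.

Lemma resD x y : xle (Some 0) (nu x) -> xle (Some 0) (nu y) ->
  res (x + y) = res x + res y.
Proof.
move=> x0 y0; rewrite -rmorphD; congr residue; apply: val_inj.
rewrite rmorphD /= !insubd_ring //.
by apply: xle_trans (valD _ _ _); apply: xle_min.
Qed.

Lemma resM x y : xle (Some 0) (nu x) -> xle (Some 0) (nu y) ->
  res (x * y) = res x * res y.
Proof.
move=> x0 y0; rewrite -rmorphM; congr residue; apply: val_inj.
rewrite rmorphM /= !insubd_ring // valM -[Some 0]xadd0a.
exact: xle_add.
Qed.

Lemma res0 : res 0 = 0.
Proof. by apply/eqP; rewrite res_eq0 val0. Qed.

Lemma res1 : res 1 = 1.
Proof. by have := resE 1; rewrite !rmorph1. Qed.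

Lemma res_sum I (r : seq I) (H : I -> F) :
  (forall i, xle (Some 0) (nu (H i))) ->
  res (\sum_(i <- r) H i) = \sum_(i <- r) res (H i).
Proof.
move=> H0; elim: r => [|i r IHr]; first by rewrite !big_nil res0.
by rewrite !big_cons resD ?IHr // val_sum_ge.
Qed.

Lemma resX x n : nu x = Some 0 -> res (x ^+ n) = res x ^+ n.
Proof.
move=> x0; elim: n => [|n IHn]; first by rewrite !expr0 res1.
by rewrite !exprS resM ?IHn ?x0 ?val_unitX ?xlexx.
Qed.

Lemma resV x : nu x = Some 0 -> res x^-1 = (res x)^-1.
Proof.
move=> x0; apply: (@mulIf _ (res x)).
  by rewrite res_eq0 x0 ?xlexx ?xlt_irr.
rewrite -resM ?x0 ?val_unitV ?xlexx // !mulVf ?res1 ?val_neq0_unit //.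
by rewrite res_eq0 x0 ?xlexx ?xlt_irr.
Qed.

End Valuation.

(* Locked, because [done] would otherwise compare residues up to conversion in
   the quotient ring. *)
HB.lock Definition res_algebraic (K L : fieldType) (iota : {rmorphism K -> L})
    (G : oagType) (nu : valuation L G) (x : L) : Prop :=
  algebraicOver (residue_field_map iota nu) (res nu x).

(** * The group of elements algebraic up to radicals *)

Section RadicalAlgebraic.
Variables (K L : fieldType) (iota : {rmorphism K -> L}).
Variables (G : oagType) (nu : valuation L G).
Implicit Types (x y z : L) (a b : K).

Notation res_alg := (res_algebraic iota nu).

Lemma res_algP x :
  res_alg x <-> algebraicOver (residue_field_map iota nu) (res nu x).
Proof. by rewrite res_algebraic.unlock. Qed.

Definition alg_unit x : Prop := nu x = Some 0 /\ res_alg x.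

Lemma alg_unitM x y : alg_unit x -> alg_unit y -> alg_unit (x * y).
Proof.
move=> [x0 xalg] [y0 yalg]; split; first by rewrite valM x0 y0 /= addr0.
apply/res_algP; rewrite resM ?x0 ?y0 ?xlexx //.
by apply: algebraic_mul; apply/res_algP.
Qed.

Lemma alg_unitX x n : alg_unit x -> alg_unit (x ^+ n).
Proof.
move=> [x0 xalg]; split; first exact: val_unitX.
by apply/res_algP; rewrite resX //; apply/algebraic_exp/res_algP.
Qed.

Lemma alg_unitV x : alg_unit x -> alg_unit x^-1.
Proof.
move=> [x0 xalg]; split; first exact: val_unitV.
by apply/res_algP; rewrite resV //; apply/algebraic_inv/res_algP.
Qed.

Lemma alg_unit_base a : nu (iota a) = Some 0 -> alg_unit (iota a).
Proof.
move=> a0; split=> //; have aO : a \in in_val_ring (restriction iota nu).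
  by rewrite -[_ \in _]/(xle (Some 0) (nu (iota a))) a0 xlexx.
have -> : iota a = val (val_ring_map (ValRing aO)) by [].
by apply/res_algP; rewrite -resE -residue_field_mapE; apply: algebraic_id.
Qed.

(* The residue condition does not depend on the choice of [n] and [a], which
   makes [radical_alg] a subgroup of [L*] closed under taking roots. *)
Definition radical_alg x : Prop := exists n a u,
  [/\ (0 < n)%N, a != 0, x ^+ n = u * iota a & alg_unit u].

Lemma radical_alg_neq0 x : radical_alg x -> x != 0.
Proof.
move=> [n [a [u [n0 a0 xE [u0 _]]]]]; apply/eqP => x0.
have : u * iota a != 0 by rewrite mulf_neq0 ?fmorph_eq0 ?(val_neq0_unit u0).
by rewrite -xE x0 expr0n -[n == 0%N]negbK -lt0n n0 eqxx.
Qed.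

Lemma radical_alg_base a : a != 0 -> radical_alg (iota a).
Proof.
move=> a0; exists 1%N, a, 1; split; rewrite ?expr1 ?mul1r //.
by rewrite -(rmorph1 iota); apply: alg_unit_base; rewrite rmorph1 val1.
Qed.

Lemma radical_algM x y : radical_alg x -> radical_alg y -> radical_alg (x * y).
Proof.
move=> [n [a [u [n0 a0 xE uU]]]] [m [b [w [m0 b0 yE wU]]]].
exists (n * m)%N, (a ^+ m * b ^+ n), (u ^+ m * w ^+ n); split.
- by rewrite muln_gt0 n0.
- by rewrite mulf_neq0 ?expf_neq0.
- rewrite exprMn {1}exprM xE mulnC exprM yE !exprMn rmorphM !rmorphXn.
  by rewrite mulrACA.
- by apply: alg_unitM; apply: alg_unitX.
Qed.

Lemma radical_algV x : radical_alg x -> radical_alg x^-1.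
Proof.
move=> [n [a [u [n0 a0 xE uU]]]]; exists n, a^-1, u^-1; split=> //.
- by rewrite invr_eq0.
- by rewrite exprVn xE invfM fmorphV.
- exact: alg_unitV.
Qed.

Lemma radical_algX x n : radical_alg x -> radical_alg (x ^+ n).
Proof.
move=> xA; elim: n => [|n IHn]; last by rewrite exprS; apply: radical_algM.
by rewrite expr0 -(rmorph1 iota); apply/radical_alg_base/oner_neq0.
Qed.

Lemma radical_alg_of_exp x n :
  (0 < n)%N -> radical_alg (x ^+ n) -> radical_alg x.
Proof.
move=> n0 [m [a [u [m0 a0 xE uU]]]]; exists (n * m)%N, a, u; split=> //.
  by rewrite muln_gt0 n0.
by rewrite exprM.
Qed.

Lemma radical_alg_mulr x y : radical_alg y -> radical_alg (x * y) ->
  radical_alg x.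
Proof.
move=> yA xyA; rewrite -[x](mulfK (radical_alg_neq0 yA)).
exact: radical_algM xyA (radical_algV yA).
Qed.

Lemma alg_unit_radical x : alg_unit x -> radical_alg x.
Proof.
move=> xU; exists 1%N, 1, x; split=> //; first exact: oner_neq0.
by rewrite expr1 rmorph1 mulr1.
Qed.

(** Value 0 of [x] forces value 0 of [iota a], so [x ^+ n] has an algebraic residue, of which the
    residue of [x] is a root. *)
Lemma radical_alg_res x : radical_alg x -> nu x = Some 0 -> res_alg x.
Proof.
move=> [n [a [u [n0 a0 xE [u0 ualg]]]]] x0.
have aU : alg_unit (iota a).
  by apply: alg_unit_base; have := val_unitX n x0; rewrite xE valM u0 xadd0a.
have := alg_unitM (conj u0 ualg) aU; rewrite -xE => -[_ /res_algP].
by rewrite resX // => /(algebraic_of_exp n0)/res_algP.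
Qed.

(** The quotient [y / x] has residue 1, hence is an [alg_unit]. *)
Lemma radical_alg_approx x y :
  radical_alg x -> xlt (nu x) (nu (x - y)) -> radical_alg y.
Proof.
move=> xA xy; have x0 := radical_alg_neq0 xA.
have d0 : xlt (Some 0) (nu ((x - y) / x)) by rewrite xlt_val_div.
have yE : y / x = 1 - (x - y) / x by rewrite mulrBl divff // subKr.
rewrite -[y](divfK x0); apply: radical_algM => //; apply: alg_unit_radical.
have yO : xle (Some 0) (nu (y / x)).
  by rewrite yE; apply: valB_ge; [rewrite val1 xlexx | apply: xltW].
have r1 : res nu (y / x) = 1.
  have : res nu (y / x + (x - y) / x) = 1 by rewrite -mulrDl subrKC divff ?res1.
  have dO := xltW d0; move: d0; rewrite resD // -res_eq0 // => /eqP->.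
  by rewrite addr0.
split; last by apply/res_algP; rewrite r1; apply: algebraic1.
have : ~~ xlt (Some 0) (nu (y / x)) by rewrite -res_eq0 // r1 oner_eq0.
by rewrite negbK => yx0; apply: xle_anti.
Qed.

Lemma exists_not_radical_alg :
  rational_rank_is (value_group_quotient iota nu) 1 \/
  transcendence_degree_is (residue_field_map iota nu) 1 ->
  exists2 x, x != 0 & ~ radical_alg x.
Proof.
move=> rank_or_trdeg.
suff H : ~ forall x, x != 0 -> radical_alg x.
  have /existsNP[x /not_implyP[x0 xA]] := H.
  by exists x.
move=> allA; case: rank_or_trdeg => [rank1|trdeg1].
  have [q qtors] := rational_rank_non_torsion rank1 isT.
  pose Q := {ideal_quot @in_base_value_group _ _ iota _ nu}.
  pose g := repr (q : Q); have qE : q = (\pi_Q g)%qT by rewrite reprK.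
  have /asboolP[x xg] := vg_valP g.
  have x0 : x != 0 by apply/eqP => E; rewrite E val0 in xg.
  have [n [a [u [n0 a0 xE [u0 _]]]]] := allA x x0.
  (* As [u] has value 0, the [n]-th multiple of the value of [x] is the value of [iota a]. *)
  case/negP: (qtors n n0); rewrite qE -[_ *+ n](raddfMn (\pi_Q)%qT).
  rewrite -(raddf0 (\pi_Q)%qT) -Quotient.idealrBE subr0.
  apply/asboolP; exists a; rewrite raddfMn /=.
  have : nu (x ^+ n) = Some (vg_val g *+ n).
    rewrite valX xg; elim: n {n0 xE} => [|n IHn] //=.
    by rewrite -/(xmuln _ _) IHn /= mulrS.
  by rewrite xE valM u0 xadd0a.
have [z ztr] := transcendence_degree1_ex trdeg1; apply: ztr.
pose y := repr z; have -> : z = res nu (val y) by rewrite -resE /residue reprK.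
have yO : xle (Some 0) (nu (val y)) := vr_valP y.
have [y0|y0] := pselect (nu (val y) = Some 0).
  exact/res_algP/(radical_alg_res (allA _ (val_neq0_unit y0)) y0).
have /eqP-> : res nu (val y) == 0; last exact: algebraic0.
rewrite res_eq0 //; apply: xlt_neq => // E; exact: y0.
Qed.

(** Reduction gives a polynomial with algebraic coefficients and root [res nu T]. It is nonzero
    because no other nonzero term shares the exponent [m i0]. *)
Lemma radical_alg_relation n (T : L) (b : 'I_n -> L) (m : 'I_n -> nat) i0 :
  nu T = Some 0 ->
  (forall i, b i = 0 \/ radical_alg (b i) /\ nu (b i) = Some 0) ->
  b i0 != 0 -> (forall i, b i != 0 -> m i = m i0 -> i = i0) ->
  xlt (Some 0) (nu (\sum_i b i * T ^+ m i)) -> radical_alg T.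
Proof.
move=> T0 bA bi0 minj sum0; apply: alg_unit_radical; split=> //.
have bO i : xle (Some 0) (nu (b i)).
  by case: (bA i) => [->|[_ ->]]; rewrite ?val0 ?xlexx.
have bTO i : xle (Some 0) (nu (b i * T ^+ m i)).
  by rewrite valM (val_unitX _ T0) xaddC xadd0a.
pose p := \sum_i (res nu (b i))%:P * 'X^(m i).
have pE k : p`_k = \sum_i res nu (b i) * (k == m i)%:R.
  by rewrite coef_sum; apply: eq_bigr => i _; rewrite coefCM coefXn.
apply/res_algP; apply: (@algebraic_root _ _ _ p).
- apply/eqP => p0; have := pE (m i0); rewrite p0 coef0 (bigD1 i0) //= eqxx.
  rewrite mulr1 big1 ?addr0 => [/esym/eqP|i ii0].
    have [b0|[_ b0]] := bA i0; first by rewrite b0 eqxx in bi0.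
    by rewrite res_eq0 // b0 (negPf (xlt_irr _)).
  have [->|bi] := eqVneq (b i) 0; first by rewrite res0 mul0r.
  case: eqP => [/esym/(minj i bi) E|_]; last by rewrite mulr0.
  by rewrite E eqxx in ii0.
- rewrite rootE horner_sum; apply/eqP; transitivity
    (res nu (\sum_i b i * T ^+ m i)).
    rewrite res_sum //; apply: eq_bigr => i _.
    rewrite hornerCM hornerXn resM ?resX // val_unitX // xlexx //.
  by apply/eqP; rewrite res_eq0 // val_sum_ge.
move=> k; rewrite pE; elim/big_ind: _ => [||i _]; first exact: algebraic0.
  by move=> x y; apply: algebraic_add.
case: (k == m i); rewrite ?mulr0 ?mulr1; last exact: algebraic0.
have [->|[bi b0]] := bA i; first by rewrite res0; apply: algebraic0.
exact/res_algP/radical_alg_res.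
Qed.

Lemma sum_powers_val_le (phi : L) n (c : 'I_n -> L) (j : 'I_n) :
  phi != 0 -> ~ radical_alg phi ->
  (forall i, c i = 0 \/ radical_alg (c i)) ->
  xle (nu (\sum_i c i * phi ^+ i)) (nu (c j * phi ^+ j)).
Proof.
move=> phi0 phiA cA; apply: contrapT => /negP jS.
(* A term of least value; by assumption the sum has larger value. *)
have [i0 _ i0min] : extremum_spec (@xle G) predT
    (fun i : 'I_n => nu (c i * phi ^+ i))
    (extremum (@xle G) j predT (fun i : 'I_n => nu (c i * phi ^+ i))).
  apply: extremumP => //; [exact: xlexx | | exact: xle_total].
  by move=> x y z; apply: xle_trans.
have i0S := xle_lt_trans (i0min j isT) jS.
have D0 : c i0 * phi ^+ i0 != 0.
  by apply/eqP => E; move: i0S; rewrite E val0 /xlt; case: (nu _).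
have c0 : c i0 != 0 by apply: contraNneq D0 => ->; rewrite mul0r.
(* After this normalization all terms are in the valuation ring, [y i0] is 1 and the sum has residue
   0. *)
pose y i := c i * phi ^+ i / (c i0 * phi ^+ i0).
have yO i : xle (Some 0) (nu (y i)).
  by rewrite -(val1 nu) -(divff D0) xle_val_div // i0min.
have sumy : \sum_i y i = (\sum_i c i * phi ^+ i) / (c i0 * phi ^+ i0).
  by rewrite mulr_suml.
have sumy_pos : xlt (Some 0) (nu (\sum_i y i)) by rewrite sumy xlt_val_div.
have yi0 : y i0 = 1 by rewrite /y divff.
have resy i : nu (y i) <> Some 0 -> res nu (y i) = 0.
  move=> yi; apply/eqP; rewrite res_eq0 //; apply: xlt_neq => // E; exact: yi.
have cU i : nu (y i) = Some 0 -> radical_alg (c i).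
  move=> yi; have [ci|//] := cA i.
  by rewrite /y ci !mul0r val0 in yi.
(* These exponents are closed under differences and multiples, so they are the multiples of the
   least positive one. *)
pose good m := exists2 h, radical_alg h & nu (phi ^+ m) = nu h.
have goodB (k m : nat) : (k <= m)%N -> good k -> good m -> good (m - k)%N.
  move=> km [h hA hE] [g gA gE]; exists (g / h).
    exact: radical_algM gA (radical_algV hA).
  have h0 := radical_alg_neq0 hA.
  by rewrite -[in LHS](mulfK h0 (phi ^+ _)) !valM -hE -gE -valM -exprD subnK.
have goodM m k : good m -> good (k * m)%N.
  move=> [h hA hE]; exists (h ^+ k); first exact: radical_algX.
  by rewrite mulnC exprM valX hE -valX.
have good_sub i k : nu (y i) = Some 0 -> nu (y k) = Some 0 -> (i <= k)%N ->
    good (k - i)%N.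
  move=> yi yk ik; exists (c i / c k).
    exact: radical_algM (cU _ yi) (radical_algV (cU _ yk)).
  have ck0 := radical_alg_neq0 (cU _ yk).
  have pi0 : phi ^+ i != 0 by rewrite expf_neq0.
  have pki : phi ^+ k = phi ^+ (k - i) * phi ^+ i by rewrite -exprD subnK.
  have /(val_div_eq0 nu _ D0) := yi; have /(val_div_eq0 nu _ D0) <- := yk.
  rewrite pki => E; apply/esym/(val_div_eq0 nu); first by rewrite expf_neq0.
  have -> : c i / c k / phi ^+ (k - i) =
      c i * phi ^+ i / (c k * (phi ^+ (k - i) * phi ^+ i)).
    by rewrite mulrA -mulf_div divff // mulr1 invfM mulrA.
  by apply/val_div_eq0 => //; rewrite !mulf_neq0 // expf_neq0.
(* The residue 1 of [y i0] must be cancelled, so a second term has value 0; the two indices differ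
   by a good exponent. *)
have ex_good : exists e, `[< (0 < e)%N /\ good e >].
  have [i1 ii yi1] : exists2 i1, i1 != i0 & nu (y i1) = Some 0.
    apply: contrapT => noi; move: sumy_pos.
    rewrite -res_eq0 ?val_sum_ge // res_sum // (bigD1 i0) //= yi0 res1.
    rewrite big1 ?addr0 ?oner_eq0 // => i ii; apply: resy => yi.
    by apply: noi; exists i.
  have yi00 : nu (y i0) = Some 0 by rewrite yi0 val1.
  case: (ltngtP i1 i0) => [lt|lt|/val_inj E]; last by rewrite E eqxx in ii.
    exists (i0 - i1)%N; apply/asboolP; rewrite subn_gt0; split=> //.
    exact: good_sub (ltnW lt).
  exists (i1 - i0)%N; apply/asboolP; rewrite subn_gt0; split=> //.
  exact: good_sub (ltnW lt).
case: (ex_minnP ex_good) => e /asboolP[e0 egood] emin.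
have good_dvd m : good m -> (e %| m)%N.
  move=> mgood; rewrite /dvdn eqn0Ngt; apply/negP => r0.
  have rgood : good (m %% e)%N.
    have -> : (m %% e = m - m %/ e * e)%N by rewrite {2}(divn_eq m e) addKn.
    by apply: goodB => //; [rewrite leq_trunc_div | apply: goodM].
  have /emin : `[< (0 < m %% e)%N /\ good (m %% e)%N >] by apply/asboolP.
  by rewrite leqNgt ltn_mod e0.
have ymod i : nu (y i) = Some 0 -> i = i0 %[mod e].
  move=> yi; have yi00 : nu (y i0) = Some 0 by rewrite yi0 val1.
  apply/eqP; have [ii|/ltnW ii] := leqP i i0.
    rewrite eq_sym (eqn_mod_dvd _ ii).
    exact/good_dvd/(good_sub _ _ yi yi00 ii).
  by rewrite (eqn_mod_dvd _ ii); apply/good_dvd/(good_sub _ _ yi00 yi ii).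
have [h hA hE] := egood; have h0 := radical_alg_neq0 hA.
pose T := phi ^+ e / h.
have T0 : nu T = Some 0 by apply/val_div_eq0.
(* Chosen so that [b i * T ^+ (i %/ e)] is [y i] times a power of [T] independent of [i]. Terms of
   larger value are dropped. *)
pose b i := if nu (y i) == Some 0 then
  c i * h ^+ (i %/ e) / (c i0 * h ^+ (i0 %/ e)) else 0.
have bT i : nu (y i) = Some 0 ->
    b i * T ^+ (i %/ e) = y i * T ^+ (i0 %/ e).
  move=> yi; rewrite /b yi eqxx /y /T !expr_div_n.
  have iE : phi ^+ i = (phi ^+ e) ^+ (i %/ e) * phi ^+ (i0 %% e).
    by rewrite -exprM -exprD -(ymod _ yi) mulnC -divn_eq.
  have i0E : phi ^+ i0 = (phi ^+ e) ^+ (i0 %/ e) * phi ^+ (i0 %% e).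
    by rewrite -exprM -exprD mulnC -divn_eq.
  have R0 : phi ^+ (i0 %% e) != 0 by rewrite expf_neq0.
  have hi := expf_neq0 (i %/ e) h0.
  have pi0 := expf_neq0 (i0 %/ e) (expf_neq0 e phi0).
  rewrite iE i0E; transitivity
    (c i / c i0 * ((phi ^+ e) ^+ (i %/ e) / h ^+ (i0 %/ e))).
    rewrite -mulf_div -[LHS]mulrA; congr (_ * _).
    by rewrite [LHS]mulrC [LHS]mulrA divfK.
  rewrite -mulf_div -[RHS]mulrA; congr (_ * _).
  by rewrite -mulf_div (divff R0) mulr1 [RHS]mulrA divfK.
have b_unit i : nu (y i) = Some 0 -> nu (b i) = Some 0.
  move=> yi; have := congr1 nu (bT i yi).
  by rewrite [LHS]valM [RHS]valM yi !(val_unitX _ T0) xaddC !xadd0a.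
have b_else i : nu (y i) <> Some 0 -> b i = 0 by rewrite /b => /eqP/negPf->.
suff TA : radical_alg T.
  apply: phiA; apply: (radical_alg_of_exp e0).
  by rewrite -[phi ^+ e](divfK h0); apply: radical_algM.
apply: (@radical_alg_relation n T b (fun i => i %/ e)%N i0 T0).
- move=> i; have [yi|yi] := pselect (nu (y i) = Some 0).
    right; split; last exact: b_unit.
    rewrite /b yi eqxx; apply: radical_algM.
      by apply: radical_algM; [apply: cU | apply: radical_algX].
    apply/radical_algV/radical_algM; last exact: radical_algX.
    by apply: cU; rewrite yi0 val1.
  by left; apply: b_else.
- by rewrite /b yi0 val1 eqxx divff ?oner_eq0 // mulf_neq0 // expf_neq0.
(* Indices in one class modulo [e] are determined by their quotient by [e]. *)
- move=> i; have [yi _ E|/b_else->] := pselect (nu (y i) = Some 0).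
    by apply: val_inj; rewrite /= (divn_eq i e) E (ymod _ yi) -divn_eq.
  by rewrite eqxx.
have bTO i : xle (Some 0) (nu (b i * T ^+ (i %/ e))).
  have [yi|/b_else->] := pselect (nu (y i) = Some 0).
    by rewrite valM (val_unitX _ T0) b_unit // xadd0a xlexx.
  by rewrite mul0r val0.
rewrite -res_eq0 ?val_sum_ge // res_sum //.
(* Dropped terms contribute residue 0 on both sides, so the sum is a multiple of the vanishing
   residue of the sum of the [y i]. *)
rewrite (eq_bigr (fun i => res nu (y i) * res nu T ^+ (i0 %/ e))) => [|i _].
  rewrite -mulr_suml -res_sum //; move: sumy_pos.
  by rewrite -res_eq0 ?val_sum_ge // => /eqP->; rewrite mul0r.
have [yi|yi] := pselect (nu (y i) = Some 0).
  by rewrite bT // resM ?resX // (val_unitX _ T0) xlexx.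
by rewrite b_else // resy // !mul0r res0.
Qed.

End RadicalAlgebraic.

(** * Evaluation of polynomials at [chi] *)

Section Evaluation.
Variables (K L : fieldType) (iota : {rmorphism K -> L}) (chi : L).
Implicit Types p q : {poly K}.
Notation ev := (eval iota chi).

Lemma evalC a : ev a%:P = iota a.
Proof. by rewrite /eval map_polyC hornerC. Qed.

Lemma evalD p q : ev (p + q) = ev p + ev q.
Proof. by rewrite /eval rmorphD hornerD. Qed.

Lemma evalB p q : ev (p - q) = ev p - ev q.
Proof. by rewrite /eval rmorphB hornerD hornerN. Qed.

Lemma evalM p q : ev (p * q) = ev p * ev q.
Proof. by rewrite /eval rmorphM hornerM. Qed.

Lemma evalZ a p : ev (a *: p) = iota a * ev p.
Proof. by rewrite -mul_polyC evalM evalC. Qed.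

Lemma evalXn p n : ev (p ^+ n) = ev p ^+ n.
Proof. by rewrite /eval rmorphXn horner_exp. Qed.

Lemma eval0 : ev 0 = 0.
Proof. by rewrite /eval rmorph0 horner0. Qed.

Lemma eval_sum I (r : seq I) (H : I -> {poly K}) :
  ev (\sum_(i <- r) H i) = \sum_(i <- r) ev (H i).
Proof. by rewrite /eval rmorph_sum horner_sum. Qed.

End Evaluation.

(** * A polynomial of minimal degree with value at [chi] outside the group *)

Section MinimalPolynomial.
Variables (K L : fieldType) (iota : {rmorphism K -> L}) (chi : L).
Variables (G : oagType) (nu : valuation L G).
Implicit Types p q f g r Phi Psi : {poly K}.
Notation ev := (eval iota chi).
Notation rad_alg := (radical_alg iota nu).

(** Since [x] is a quotient of two elements of K[chi], one of these is nonzero and outside the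
    group. A polynomial of least size with such an evaluation is made monic. *)
Lemma exists_minimal_polynomial :
  is_generator iota chi -> (exists2 x, x != 0 & ~ rad_alg x) ->
  exists Phi, [/\ Phi \is monic, (1 < size Phi)%N, ~ rad_alg (ev Phi) &
    (forall p, p != 0 -> (size p <= size Phi)%N -> ev p != 0) /\
    (forall p, ev p != 0 -> (size p < size Phi)%N -> rad_alg (ev p))].
Proof.
move=> chi_gen [x x0 xA].
have bad_ex : exists n, `[< exists p,
    [/\ size p = n, ev p != 0 & ~ rad_alg (ev p)] >].
  have [p [q [q0 xE]]] := chi_gen x.
  have p0 : ev p != 0 by apply: contraNneq x0 => p0; rewrite xE p0 mul0r.
  have [pA|pA] := pselect (rad_alg (ev p)); last first.
    by exists (size p); apply/asboolP; exists p.
  exists (size q); apply/asboolP; exists q; split=> // qA; apply: xA.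
  by rewrite xE; apply: radical_algM pA (radical_algV qA).
case: (ex_minnP bad_ex) => n /asboolP[P [Pn P0 PA]] Pmin.
have min p : ev p != 0 -> (size p < n)%N -> rad_alg (ev p).
  move=> p0; apply: contraTP => pA; rewrite -leqNgt Pmin //.
  by apply/asboolP; exists p.
have lc0 : lead_coef P != 0.
  by rewrite lead_coef_eq0; apply: contraNneq P0 => ->; rewrite eval0.
have iP0 : (lead_coef P)^-1 != 0 by rewrite invr_eq0.
pose Phi := (lead_coef P)^-1 *: P.
have sPhi : size Phi = n by rewrite size_scale.
have PhiA : ~ rad_alg (ev Phi).
  rewrite evalZ mulrC => H; apply: PA.
  by apply: radical_alg_mulr H; apply: radical_alg_base.
have Phi0 : ev Phi != 0 by rewrite evalZ mulf_neq0 // fmorph_eq0.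
exists Phi; split=> //.
- by rewrite monicE lead_coefZ mulVf.
- rewrite ltnNge; apply/negP => /size1_polyC E; apply: PhiA.
  rewrite E evalC; apply: radical_alg_base.
  by apply: contraNneq Phi0 => E0; rewrite E E0 eval0.
split=> p; last by rewrite sPhi; apply: min.
(* If [p] vanished at [chi], then [Phi %% p] would evaluate like [Phi] and have smaller size. *)
move=> p0 sp; apply: contra_notN PhiA => /eqP evp.
have PhiE : ev Phi = ev (Phi %% p).
  by rewrite {1}(divp_eq Phi p) evalD evalM evp mulr0 add0r.
rewrite PhiE; apply: min; first by rewrite -PhiE.
by apply: leq_trans (ltn_modpN0 _ p0) _; rewrite -sPhi.
Qed.

Section Minimal.
Variable Phi : {poly K}.
Hypotheses (Phi_monic : Phi \is monic) (Phi_gt1 : (1 < size Phi)%N).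
Hypothesis PhiA : ~ rad_alg (ev Phi).
Hypothesis ev_neq0 : forall p, p != 0 -> (size p <= size Phi)%N -> ev p != 0.
Hypothesis Phi_min :
  forall p, ev p != 0 -> (size p < size Phi)%N -> rad_alg (ev p).

Let Phi0 : Phi != 0. Proof. exact: monic_neq0. Qed.
Let evPhi0 : ev Phi != 0. Proof. exact: ev_neq0. Qed.

Let small_alg p : p != 0 -> (size p < size Phi)%N -> rad_alg (ev p).
Proof. by move=> p0 sp; apply: Phi_min => //; apply: ev_neq0 (ltnW sp). Qed.

(** The powers of [chi] up to this exponent are independent, as no nonzero polynomial of size at
    most [size Phi] vanishes at [chi]. *)
Lemma minimal_lt_degree : lt_degree iota chi (size Phi).-1.
Proof.
exists (fun i => 'X^i) => c csum.
pose p := \poly_(i < (size Phi).-1.+1) c (inord i).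
have pE i : c i = p`_i by rewrite coef_poly inord_val ltn_ord.
have evp : ev p = 0.
  rewrite -csum /p poly_def eval_sum; apply: eq_bigr => i _.
  by rewrite inord_val evalZ.
have sp : (size p <= size Phi)%N.
  by rewrite -[leqRHS](ltn_predK Phi_gt1) size_poly.
have [p0|p0] := eqVneq p 0; first by move=> i; rewrite pE p0 coef0.
by have := ev_neq0 p0 sp; rewrite evp eqxx.
Qed.

Lemma small_sum_val_le n (c : 'I_n -> {poly K}) j :
  (forall i, (size (c i) < size Phi)%N) ->
  xle (nu (ev (\sum_i c i * Phi ^+ i))) (nu (ev (c j * Phi ^+ j))).
Proof.
move=> sc; rewrite eval_sum evalM evalXn.
rewrite (eq_bigr (fun i => ev (c i) * ev Phi ^+ i)) => [|i _]; last first.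
  by rewrite evalM evalXn.
apply: (sum_powers_val_le _ evPhi0 PhiA) => i.
have [->|ci] := eqVneq (c i) 0; first by left; apply: eval0.
by right; apply: small_alg.
Qed.

(** In the expansion of [r + g * Phi] in powers of [Phi], [r] is the term of index 0 and the
    coefficients of [g] are shifted by one. *)
Lemma small_add_val_le r g : (size r < size Phi)%N ->
  xle (nu (ev (r + g * Phi))) (nu (ev r)).
Proof.
move=> sr; pose c (i : 'I_(size g).+1) :=
  if unlift ord0 i is Some k then expansion_coef Phi g k else r.
have -> : r + g * Phi = \sum_i c i * Phi ^+ i.
  rewrite big_ord_recl /c unlift_none expr0 mulr1; congr (_ + _).
  rewrite {1}(expansionE g Phi_gt1) mulr_suml; apply: eq_bigr => i _.
  by rewrite liftK exprSr mulrA.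
have -> : r = c ord0 * Phi ^+ (ord0 : 'I_(size g).+1).
  by rewrite /c unlift_none mulr1.
apply: small_sum_val_le => i; rewrite /c; case: unlift => // k.
exact: size_expansion_coef.
Qed.

(** The value is at most that of each term by [small_sum_val_le]; the reverse is the ultrametric
    inequality. *)
Lemma expansion_valE f : nu (ev f) = expansion_val iota chi nu Phi f.
Proof.
have termE i : xadd (nu_eval iota chi nu (expansion_coef Phi f i))
    (xmuln (nu_eval iota chi nu Phi) i) =
    nu (ev (expansion_coef Phi f i * Phi ^+ i)).
  by rewrite evalM evalXn valM valX.
apply: xle_anti.
  apply/xle_bigmin => i _; rewrite termE {1}(expansionE f Phi_gt1).
  by apply: small_sum_val_le => k; apply: size_expansion_coef.
rewrite {2}(expansionE f Phi_gt1) eval_sum; apply: val_sum_ge => i _.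
rewrite -termE.
exact: (xle_bigmin _ _ _).1 (xlexx _) i (mem_index_enum i).
Qed.

Lemma minimal_w_key : w_key_polynomial iota chi nu Phi.
Proof.
split=> //; [by rewrite -subn1 subn_gt0 | exact: minimal_lt_degree |].
have ltE p : (size p <= (size Phi).-1)%N = (size p < size Phi)%N.
  by rewrite -ltnS prednK // ltnW.
move=> f g f0 g0; rewrite !ltE => sf sg _.
rewrite /nu_eval; set q := (f * g) %/ Phi; set r := (f * g) %% Phi.
have sr : (size r < size Phi)%N by rewrite ltn_modp.
have fgE : f * g = r + q * Phi by rewrite addrC -divp_eq.
apply: xle_anti; first by rewrite fgE small_add_val_le.
apply/negPn/negP => fg_lt_r.
have qPhiA : rad_alg (ev q * ev Phi).
  apply: (radical_alg_approx (x := ev (f * g))).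
    by rewrite evalM; apply: radical_algM; apply: small_alg.
  by rewrite -evalM -evalB {2}fgE addrK.
have q0 : q != 0.
  apply/eqP => q0; have := radical_alg_neq0 qPhiA.
  by rewrite q0 eval0 mul0r eqxx.
apply: PhiA; apply: (radical_alg_mulr (y := ev q)); last by rewrite mulrC.
(* As [f] and [g] have smaller degree than [Phi], so has the quotient [q] of their product by
   [Phi]. *)
apply: small_alg => //; rewrite size_divp // size_mul //.
by move: (size f) (size g) (size Phi) sf sg Phi_gt1 => k m n *; lia.
Qed.

Lemma key_degree_le d : key_degree iota chi nu d -> (d <= (size Phi).-1)%N.
Proof.
move=> [Psi [_ d0 ltd key] sPsi]; rewrite sPsi /= in d0 ltd key.
rewrite leqNgt; apply/negP => lt_d.
pose g := Psi %/ Phi.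
have sg : size g = (d.+1 - (size Phi).-1)%N by rewrite size_divp // sPsi.
have g0 : g != 0 by rewrite -size_poly_gt0 sg; lia.
pose r := Psi %% Phi.
have PsiE : Psi = r + g * Phi by rewrite addrC -divp_eq.
have sr : (size r < size Phi)%N by rewrite ltn_modp.
have gE : Phi * g = Psi - r by rewrite PsiE addrAC subrr add0r mulrC.
(* This is the euclidean division of [Phi * g] by [Psi]: quotient 1, remainder [- r]. *)
have qr : Phi * g = 1 * Psi + - r by rewrite mul1r.
have srN : (size (- r) < size Psi)%N.
  by rewrite size_polyN sPsi; move: (size r) (size Phi) sr lt_d => *; lia.
have [] := key Phi g Phi0 g0.
- by move: (size Phi) lt_d => *; lia.
- by rewrite sg; move: (size Phi) Phi_gt1 => *; lia.
(* The degrees add up to that of [Psi], which is below the degree of [chi] by [ltd]. *)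
- suff -> : ((size Phi).-1 + (size g).-1 = d)%N by [].
  by rewrite sg; move: (size Phi) Phi_gt1 lt_d => *; lia.
(* The key inequality would put the value of [Phi * g] below that of [Psi], but [Phi * g] is
   [Psi - r] and [r] has at least the value of [Psi]. *)
move=> <-; rewrite -(divpP qr srN) /nu_eval mul1r; apply/negP; rewrite negbK.
by rewrite gE evalB valB_ge ?xlexx // {1}PsiE small_add_val_le.
Qed.

End Minimal.
End MinimalPolynomial.

Theorem proposition4p7 (K L : fieldType) (iota : {rmorphism K -> L}) (chi : L)
    (G : oagType) (nu : valuation L G)
    (L_eq_Kchi : is_generator iota chi)
    (finite_rank_K : finite_rank (value_group (restriction iota nu)))
    (rank_or_trdeg :
      rational_rank_is (value_group_quotient iota nu) 1 \/
      transcendence_degree_is (residue_field_map iota nu) 1) :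
  finite_set [set d : nat | key_degree iota chi nu d] /\
  exists2 Phi : {poly K}, w_key_polynomial iota chi nu Phi &
    forall f : {poly K}, nu (eval iota chi f) = expansion_val iota chi nu Phi f.
Proof.
have [Phi [Phi_monic Phi_gt1 PhiA [ev_neq0 Phi_min]]] :=
  exists_minimal_polynomial L_eq_Kchi (exists_not_radical_alg rank_or_trdeg).
split; last first.
  exists Phi; first exact: minimal_w_key.
  by move=> f; apply: expansion_valE.
apply: (sub_finite_set (B := [set d | (d < size Phi)%N])); last first.
  exact: finite_II.
move=> d /= /(key_degree_le Phi_monic Phi_gt1 PhiA ev_neq0 Phi_min).
by rewrite -ltnS prednK // ltnW.
Qed.
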